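(* Let $\gamma\geq1$, $r,s\geq0$, $\tau\in[0,1]$ and let $t$ satisfy $$t\geq\begin{cases} r+s\,\tau^{1/\gamma} & \text{if } 1/2\leq\tau\leq1,\\ r+s\,(1+\tau^2)^{1/(2\gamma)} & \text{if } 0\leq\tau<1/2.\end{cases}$$ Then for every $x,\omega,y,\eta\in\mathbb{R}^d$, $$\frac{w^\gamma_{r+s}(x,\omega)}{w^\gamma_r(y,\eta)}\leq \big(w^\gamma_s\otimes w^\gamma_t\big)\Big(\big((1-\tau)x+\tau y,\ \tau\omega+(1-\tau)\eta\big),\ \big(\omega-\eta,\ y-x\big)\Big).$$
   Context: For $k\geq0$, $\gamma>0$ and $n\in\mathbb{N}$: $w^\gamma_k(z)=e^{k|z|^{1/\gamma}}$ for $z\in\mathbb{R}^n$, where $|\cdot|$ is the Euclidean norm; here the functions $w^\gamma_k$ are taken on $\mathbb{R}^{2d}$. The tensor product is $(w^\gamma_s\otimes w^\gamma_t)(z,\zeta)=w^\gamma_s(z)\,w^\gamma_t(\zeta)$ for $z,\zeta\in\mathbb{R}^{2d}$. *)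

(* Defs.v *)
From mathcomp Require Import all_boot all_order all_algebra.
From mathcomp Require Import all_classical all_reals all_analysis.

Set Implicit Arguments.
Unset Strict Implicit.
Unset Printing Implicit Defensive.

Import Order.TTheory GRing.Theory Num.Theory.

Local Open Scope ring_scope.

(* MathComp-Analysis equips 'rV[R]_n with the sup norm `|z|, so the Euclidean
   norm has to be defined separately. *)
Definition enorm (R : realType) (n : nat) (z : 'rV[R]_n) : R :=
  Num.sqrt (\sum_(i < n) z 0 i ^+ 2).

(* Since 0 `^ a = 0 for a != 0, the weight is equal to 1 at z = 0 when
   gamma > 0. *)
Definition weight (R : realType) (gamma k : R) (n : nat) (z : 'rV[R]_n) : R :=
  expR (k * enorm z `^ (1 / gamma)).

Definition tensor (R : realType) (U V : Type) (f : U -> R) (g : V -> R) :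
  U * V -> R := fun p => f p.1 * g p.2.

(* Main.v *)
Require Import Defs.
From mathcomp Require Import all_boot all_order all_algebra.
From mathcomp Require Import all_classical all_reals all_analysis.
From mathcomp Require Import ring lra.

(** With exponent [a = 1 / gamma] in (0, 1], the map [z |-> |z|^a] is
    subadditive: combine the triangle inequality for the Euclidean norm
    ([enormD]) with the subadditivity of [u |-> u^a] on nonnegative reals
    ([powR_subadd]).  Taking logarithms and writing [X = (x, omega)],
    [Y = (y, eta)], [Z] and [W] for the two arguments on the right-hand side,
    the claim becomes [(r + s) |X|^a <= r |Y|^a + s |Z|^a + t |W|^a].

    The vector [W] is [X - Y] with its blocks swapped and one sign changed, so
    [|X - Y| = |W|], which gives [r |X|^a <= r |Y|^a + r |W|^a].  On the other
    hand [X - Z = (tau (x - y), (1 - tau) (omega - eta))] is a coordinatewise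
    contraction of [X - Y] by a factor at most [max (tau, 1 - tau)], hence
    [s |X|^a <= s |Z|^a + s c^a |W|^a] as soon as [tau, 1 - tau <= c].  For
    [tau >= 1/2] one takes [c = tau], and for [tau < 1/2] one takes
    [c = (1 + tau^2)^(1/2)], which is at least 1; in both cases the hypothesis
    on [t] reads [r + s c^a <= t]. *)

Set Implicit Arguments.
Unset Strict Implicit.
Unset Printing Implicit Defensive.

Import Order.TTheory GRing.Theory Num.Theory.

Local Open Scope ring_scope.

Lemma enorm_ge0 (R : realType) n (u : 'rV[R]_n) : 0 <= enorm u.
Proof. exact: sqrtr_ge0. Qed.

Lemma enorm_sqr (R : realType) n (u : 'rV[R]_n) :
  enorm u ^+ 2 = \sum_(i < n) u 0 i ^+ 2.
Proof. by rewrite sqr_sqrtr// sumr_ge0// => i _; exact: sqr_ge0. Qed.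

Lemma cauchy_schwarz_enorm (R : realType) n (u v : 'rV[R]_n) :
  \sum_(i < n) u 0 i * v 0 i <= enorm u * enorm v.
Proof.
have enorm0 (w : 'rV[R]_n) : enorm w = 0 -> forall i, w 0 i = 0.
  move=> w0 i; have /esym/eqP := enorm_sqr w.
  rewrite w0 expr0n/= psumr_eq0 => [/allP/(_ i)|j _]; last exact: sqr_ge0.
  by rewrite mem_index_enum sqrf_eq0 => /(_ isT)/eqP.
have [u0|u_neq0] := eqVneq (enorm u) 0.
  by rewrite u0 mul0r big1// => i _; rewrite enorm0// mul0r.
have [v0|v_neq0] := eqVneq (enorm v) 0.
  by rewrite v0 mulr0 big1// => i _; rewrite (enorm0 v)// mulr0.
have uv_gt0 : 0 < enorm u * enorm v by rewrite mulr_gt0// lt0r enorm_ge0 andbT.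
(* After rescaling, |v| u and |u| v have the same norm, so that the
   nonnegativity of | |v| u - |u| v |^2 is already the sharp inequality. *)
have : 0 <= \sum_(i < n) (enorm v * u 0 i - enorm u * v 0 i) ^+ 2.
  by apply: sumr_ge0 => i _; exact: sqr_ge0.
have -> : \sum_(i < n) (enorm v * u 0 i - enorm u * v 0 i) ^+ 2 =
    enorm v ^+ 2 * enorm u ^+ 2 + enorm u ^+ 2 * enorm v ^+ 2
    - 2 * (enorm u * enorm v) * \sum_(i < n) u 0 i * v 0 i.
  rewrite {1}(enorm_sqr u) {2}(enorm_sqr v) !mulr_sumr -big_split -sumrB/=.
  by apply: eq_bigr => i _; ring.
set S := \sum_(i < n) _ => h.
by rewrite -(ler_pM2l uv_gt0); lra.
Qed.

Lemma enormD (R : realType) n (u v : 'rV[R]_n) :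
  enorm (u + v) <= enorm u + enorm v.
Proof.
rewrite -(@ler_pXn2r _ 2)// ?nnegrE ?addr_ge0 ?enorm_ge0//.
have -> : enorm (u + v) ^+ 2 =
    enorm u ^+ 2 + enorm v ^+ 2 + 2 * \sum_(i < n) u 0 i * v 0 i.
  rewrite !enorm_sqr mulr_sumr -!big_split/=.
  by apply: eq_bigr => i _; rewrite mxE; ring.
by have := cauchy_schwarz_enorm u v; lra.
Qed.

Lemma enorm_sqrZ (R : realType) n (a : R) (u : 'rV[R]_n) :
  enorm (a *: u) ^+ 2 = a ^+ 2 * enorm u ^+ 2.
Proof.
by rewrite !enorm_sqr mulr_sumr; apply: eq_bigr => i _; rewrite mxE exprMn.
Qed.

Lemma enorm_sqr_row_mx (R : realType) m n (u : 'rV[R]_m) (v : 'rV[R]_n) :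
  enorm (row_mx u v) ^+ 2 = enorm u ^+ 2 + enorm v ^+ 2.
Proof.
rewrite !enorm_sqr big_split_ord/=.
by congr (_ + _); apply: eq_bigr => i _; rewrite ?row_mxEl ?row_mxEr.
Qed.

(** The rotation [(u, v) |-> (v, - u)] preserves the Euclidean norm, and
    scaling the two blocks by different factors multiplies the norm by at most
    the larger one.  The rotated form is the one in which the increments of
    position and frequency enter the weight with parameter [t]. *)
Lemma enorm_row_mx_scale_le (R : realType) d (a b c : R) (u v : 'rV[R]_d) :
  0 <= a <= c -> 0 <= b <= c ->
  enorm (row_mx (a *: u) (b *: v)) <= c * enorm (row_mx v (- u)).
Proof.
move=> /andP[a0 ac] /andP[b0 bc]; have c0 := le_trans a0 ac.
rewrite -(@ler_pXn2r _ 2)// ?nnegrE ?mulr_ge0 ?enorm_ge0//.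
rewrite exprMn !enorm_sqr_row_mx !enorm_sqrZ -scaleN1r enorm_sqrZ.
rewrite sqrrN expr1n mul1r mulrDr addrC.
by rewrite lerD// ler_wpM2r ?sqr_ge0// ler_pXn2r.
Qed.

(** By homogeneity one may assume [u + v = 1], and there it suffices that
    [p <= p^a] on the unit interval. *)
Lemma powR_subadd (R : realType) (a u v : R) : 0 <= a <= 1 ->
  0 <= u -> 0 <= v -> (u + v) `^ a <= u `^ a + v `^ a.
Proof.
move=> /andP[a0 a1] u0 v0; have [uv0|uv_neq0] := eqVneq (u + v) 0.
  have -> : u = 0 by lra.
  have -> : v = 0 by lra.
  by rewrite addr0 lerDl powR_ge0.
have uv_gt0 : 0 < u + v by rewrite lt0r uv_neq0 addr_ge0.
have scaled w : 0 <= w <= u + v -> (u + v) `^ a * (w / (u + v)) <= w `^ a.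
  move=> /andP[w0 wuv].
  rewrite -[in leRHS](divfK uv_neq0 w) mulrC powRM ?divr_ge0 ?(ltW uv_gt0)//.
  rewrite ler_wpM2r ?powR_ge0//.
  have [->|w_neq0] := eqVneq w 0; first by rewrite mul0r powR_ge0.
  apply: ger1_powR => //.
  by rewrite divr_gt0 ?lt0r ?w_neq0 ?w0 ?uv_neq0 ?addr_ge0//= ler_pdivrMr ?mul1r.
have -> : (u + v) `^ a =
    (u + v) `^ a * (u / (u + v)) + (u + v) `^ a * (v / (u + v)).
  by rewrite -mulrDr -mulrDl divff// mulr1.
by apply: lerD; apply: scaled; lra.
Qed.

Lemma powR_enorm_le (R : realType) n (a w : R) (u v : 'rV[R]_n) :
  0 <= a <= 1 -> 0 <= w -> enorm (u - v) <= w ->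
  enorm u `^ a <= enorm v `^ a + w `^ a.
Proof.
move=> a01 w0 uvw; have /andP[a0 _] := a01.
apply: le_trans (powR_subadd a01 (enorm_ge0 v) w0).
apply: ge0_ler_powR; rewrite ?nnegrE ?addr_ge0 ?enorm_ge0//.
rewrite -[in leLHS](subrKC v u).
by apply: le_trans (enormD _ _) _; rewrite lerD2l.
Qed.

Theorem lemma2p4 (R : realType) (d : nat) (gamma r s tau t : R)
    (hgamma : 1 <= gamma) (hr : 0 <= r) (hs : 0 <= s) (htau : 0 <= tau <= 1)
    (ht_ge : 1 / 2 <= tau <= 1 -> r + s * tau `^ (1 / gamma) <= t)
    (ht_lt : 0 <= tau < 1 / 2 ->
       r + s * (1 + tau ^+ 2) `^ (1 / (2 * gamma)) <= t)
    (x omega y eta : 'rV[R]_d) :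
  weight gamma (r + s) (row_mx x omega) / weight gamma r (row_mx y eta) <=
  tensor (@weight R gamma s (d + d)) (@weight R gamma t (d + d))
    (row_mx ((1 - tau) *: x + tau *: y) (tau *: omega + (1 - tau) *: eta),
     row_mx (omega - eta) (y - x)).
Proof.
have gamma_gt0 : 0 < gamma by lra.
have a01 : 0 <= 1 / gamma <= 1.
  by rewrite divr_ge0 ?(ltW gamma_gt0)//= ler_pdivrMr ?mul1r.
have [c [tau_c tau'_c hc]] : exists c : R,
    [/\ tau <= c, 1 - tau <= c & r + s * c `^ (1 / gamma) <= t].
  have [tau_ge|tau_lt] := leP (1 / 2) tau.
    exists tau; split; [by []|by lra|].
    by apply: ht_ge; rewrite tau_ge; case/andP: htau.
  exists ((1 + tau ^+ 2) `^ (1 / 2)).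
  have c_ge1 : 1 <= (1 + tau ^+ 2) `^ (1 / 2).
    rewrite -[leLHS](powRr0 (1 + tau ^+ 2)).
    by apply: ler_powR; rewrite ?lerDl ?sqr_ge0//; lra.
  split; [by lra|by lra|].
  rewrite -powRrM mulf_div mulr1; apply: ht_lt; rewrite tau_lt.
  by case/andP: htau => ->.
rewrite /tensor /weight [fst _]/fst [snd _]/snd.
rewrite ler_pdivrMr ?expR_gt0//.
rewrite -[in leRHS](expRD (s * _)) -[in leRHS](expRD (_ + _)) ler_expR.
set W := row_mx (omega - eta) (y - x).
set Z := row_mx (_ + _) _.
have WE : W = row_mx (omega - eta) (- (x - y)) by rewrite opprB.
have XY : enorm (row_mx x omega - row_mx y eta) <= enorm W.
  rewrite opp_row_mx add_row_mx -[x - y]scale1r -[omega - eta]scale1r.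
  rewrite -[leRHS]mul1r WE.
  by apply: enorm_row_mx_scale_le; rewrite ler01 lexx.
have XZ : enorm (row_mx x omega - Z) <= c * enorm W.
  rewrite opp_row_mx add_row_mx.
  have -> : x - ((1 - tau) *: x + tau *: y) = tau *: (x - y).
    by apply/rowP => i; rewrite !mxE; ring.
  have -> : omega - (tau *: omega + (1 - tau) *: eta)
      = (1 - tau) *: (omega - eta).
    by apply/rowP => i; rewrite !mxE; ring.
  by rewrite WE; apply: enorm_row_mx_scale_le; lra.
have c0 : 0 <= c by lra.
have := powR_enorm_le a01 (enorm_ge0 W) XY.
have := powR_enorm_le a01 (mulr_ge0 c0 (enorm_ge0 W)) XZ.
rewrite powRM ?enorm_ge0//.
have := powR_ge0 (enorm W) (1 / gamma).
set X' := enorm (row_mx x omega) `^ _; set Y' := enorm (row_mx y eta) `^ _.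
set Z' := enorm Z `^ _; set W' := enorm W `^ _; set C := c `^ _ in hc *.
move=> W0 /(ler_wpM2l hs) sXZ /(ler_wpM2l hr) rXY.
have := ler_wpM2r W0 hc.
by lra.
Qed.
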